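(* Let $l=l(x,z)$ be a smooth function satisfying $$\frac{\partial l}{\partial z}-3\,l\,\frac{\partial l}{\partial x}+\frac{\partial^3l}{\partial x^3}=0,$$ let $\Pi^k_{ij}$ ($i,j,k\in\{1,2,3\}$) be the Christoffel symbols, in the coordinates $(x^1,x^2,x^3)=(x,y,z)$ with $y\neq0$, of the three-dimensional metric $$y^2dx^2+2\left(y^2l-\tfrac12\right)dx\,dz+2\,dy\,dz+\left(y^2l^2-2y\,\frac{\partial l}{\partial x}+l\right)dz^2,$$ and let $ds^2$ be the six-dimensional metric in coordinates $(x,y,z,u,v,w)$, with $(\xi_1,\xi_2,\xi_3)=(u,v,w)$, given by $$ds^2=-2\sum_{i,j,k=1}^{3}\Pi^k_{ij}(x,y,z)\,\xi_k\,dx^i\,dx^j+2\sum_{k=1}^{3}d\xi_k\,dx^k .$$ Then for every constant $\epsilon\neq0$ the six-dimensional metric $$d\tilde s^2=ds^2+\epsilon\,dy^2$$ is Ricci-flat, $R_{ik}=0$, but has nonzero Riemann curvature tensor, $R_{ijkl}\not\equiv0$.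
   Context: $R_{ijkl}$ and $R_{ik}$ denote the Riemann curvature tensor and the Ricci tensor of the six-dimensional metric $d\tilde s^2$. In line elements, $dx^i\,dx^j$ denotes the symmetric product, so that for $i\neq j$ the total coefficient of $dx^i\,dx^j$ equals $2g_{ij}$. All functions are smooth functions of real variables on suitable open domains with $y\neq0$. *)

(* Defs.v *)
From HB Require Import structures.
From mathcomp Require Import all_boot all_order all_algebra.
From mathcomp Require Import all_classical all_reals all_analysis.

Set Implicit Arguments.
Unset Strict Implicit.
Unset Printing Implicit Defensive.

Import Order.TTheory GRing.Theory Num.Theory.
Import numFieldNormedType.Exports.

Local Open Scope classical_set_scope.
Local Open Scope ring_scope.

Section Calculus.
Context {R : realType} {n : nat}.
Implicit Types (f : 'rV[R]_n -> R) (D : set 'rV[R]_n).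

Definition partial (i : 'I_n) f : 'rV[R]_n -> R := 'D_(delta_mx 0 i) f.

Definition iter_partial (s : seq 'I_n) f : 'rV[R]_n -> R := foldr partial f s.

(* C^oo on D (meant for open D): partial derivatives of all orders exist and
   are continuous at every point of D. *)
Definition smooth_on D f : Prop :=
  forall (s : seq 'I_n) (p : 'rV[R]_n), D p ->
    {for p, continuous (iter_partial s f)} /\
    forall i : 'I_n, derivable (iter_partial s f) p (delta_mx 0 i).

End Calculus.

(* A metric in coordinates is given by its Gram matrix: g p i j = g_{ij}(p).
   Index conventions:
     christoffel g k i j      = Gamma^k_{ij}
     riemann_up g m j k l     = R^m_{jkl}
                              = d_k Gamma^m_{lj} - d_l Gamma^m_{kj}
                                + Gamma^m_{ks} Gamma^s_{lj}
                                - Gamma^m_{ls} Gamma^s_{kj}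
     riemann g i j k l        = R_{ijkl} = g_{im} R^m_{jkl}
     ricci g i k              = R_{ik} = R^m_{imk}.
   [invmx] is the inverse metric only where g p is invertible. *)
Section Curvature.
Context {R : realType} {n : nat}.
Variable g : 'rV[R]_n -> 'M[R]_n.

Definition christoffel (k i j : 'I_n) (p : 'rV[R]_n) : R :=
  2^-1 * \sum_(m < n) invmx (g p) k m *
    (partial i (fun q => g q m j) p + partial j (fun q => g q m i) p
     - partial m (fun q => g q i j) p).

Definition riemann_up (m j k l : 'I_n) (p : 'rV[R]_n) : R :=
  partial k (christoffel m l j) p - partial l (christoffel m k j) p
  + \sum_(s < n) (christoffel m k s p * christoffel s l j p
                  - christoffel m l s p * christoffel s k j p).

Definition riemann (i j k l : 'I_n) (p : 'rV[R]_n) : R :=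
  \sum_(m < n) g p i m * riemann_up m j k l p.

Definition ricci (i k : 'I_n) (p : 'rV[R]_n) : R :=
  \sum_(m < n) riemann_up m i m k p.

End Curvature.

(* - 2 Pi^k_{ij} xi_k dx^i dx^j + 2 dxi_k dx^k on R^(n + n), with
   Pi k i j = Pi^k_{ij}; the point p is (x, xi) = (lsubmx p, rsubmx p).
   The off-diagonal blocks are 1 since 2 dxi_k dx^k is a symmetric product. *)
Definition riemann_extension (R : realType) (n : nat)
    (Pi : 'I_n -> 'I_n -> 'I_n -> 'rV[R]_n -> R)
    (p : 'rV[R]_(n + n)) : 'M[R]_(n + n) :=
  block_mx
    (\matrix_(i < n, j < n)
       (- 2 * \sum_(k < n) Pi k i j (lsubmx p) * rsubmx p 0 k)) 1%:M
    1%:M                                                        0.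

Section Metrics.
Context {R : realType}.

(* (x, y, z) |-> (x, z) *)
Definition proj_xz (p : 'rV[R]_3) : 'rV[R]_2 :=
  \row_(j < 2) [:: p 0 0; p 0 2]`_j.

(* The coordinates of 'rV_2 are (x, z): [partial 0] is d/dx and [partial 1]
   is d/dz. *)
Definition kdv_equation (l : 'rV[R]_2 -> R) (q : 'rV[R]_2) : Prop :=
  partial 1 l q - 3 * l q * partial 0 l q
  + partial 0 (partial 0 (partial 0 l)) q = 0.

Definition metric3 (l : 'rV[R]_2 -> R) (p : 'rV[R]_3) : 'M[R]_3 :=
  let y := p 0 1 in
  let L := l (proj_xz p) in
  let Lx := partial 0 l (proj_xz p) in
  \matrix_(i < 3, j < 3) (nth [::]
    [:: [:: y ^+ 2;           0; y ^+ 2 * L - 2^-1                   ];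
        [:: 0;                0; 1                                   ];
        [:: y ^+ 2 * L - 2^-1; 1; y ^+ 2 * L ^+ 2 - 2 * y * Lx + L   ]] i)`_j.

(* ds^2 + eps dy^2 on R^(3 + 3), coordinates (x, y, z, u, v, w). *)
Definition metric6 (l : 'rV[R]_2 -> R) (eps : R) (p : 'rV[R]_(3 + 3)) :
    'M[R]_(3 + 3) :=
  riemann_extension (christoffel (metric3 l)) p
  + eps *: delta_mx (lshift 3 1) (lshift 3 1).

End Metrics.

(* Main.v *)
(* The inverse of the Gram matrix [[A, 1], [1, 0]] of a (deformed) Riemann
   extension is [[0, 1], [1, -A]], so all Christoffel symbols are those of the
   connection Pi, up to the ones with an upper fibre index and two lower base
   indices.  A deformation phi_ij dx^i dx^j that does not depend on the fibre
   variables changes only the latter, by terms independent of the fibre, and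
   these do not enter the Ricci tensor: its only nonzero block is the
   symmetrised Ricci tensor of Pi.  For the three-dimensional metric the only
   Ricci component not identically zero is
   R_33 = (l_z - 3 l l_x + l_xxx) / y.
   The deformation does enter the Riemann tensor: it contributes
   R_1212 = - eps / (4 y^2), which never vanishes. *)
Require Import Defs.
From HB Require Import structures.
From mathcomp Require Import all_boot all_order all_algebra.
From mathcomp Require Import all_classical all_reals all_analysis.
From mathcomp Require Import ring lra.
Import Order.TTheory GRing.Theory Num.Theory.
Import numFieldNormedType.Exports.
Local Open Scope classical_set_scope.
Local Open Scope ring_scope.

(** * Derivatives along linear maps and symmetry of mixed derivatives *)

Lemma is_derive_comp_linear (R : numFieldType) (U V W : normedModType R)
    (L : U -> V) (f : V -> W) (a v : U) (df : W) :
  linear L -> is_derive (L a) (L v) f df ->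
  is_derive a v (fun q => f (L q)) df.
Proof.
move=> linL [fd fE].
(* By linearity [L (h v + a) = h L v + L a], so both difference quotients are the same function of
   [h]. *)
have E : (fun h : R => h^-1 *: (((fun q => f (L q)) \o shift a) (h *: v)
             - f (L a))) =
         (fun h : R => h^-1 *: ((f \o shift (L a)) (h *: L v) - f (L a))).
  by apply/funext => h /=; rewrite linL.
by apply: DeriveDef; rewrite /derivable /derive E.
Qed.

Section MixedDerivatives.
Variables (R : realType) (V : normedModType R) (f : V -> R).

Lemma is_derive_line (p u : V) (s : R) :
  derivable f (p + s *: u) u ->
  is_derive s 1 (fun t : R => f (p + t *: u)) ('D_u f (p + s *: u)).
Proof.
move=> fd.
have E : (fun h : R => h^-1 *: (((fun t : R => f (p + t *: u)) \o shift s)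
             (h *: 1) - f (p + s *: u))) =
         (fun h : R => h^-1 *: ((f \o shift (p + s *: u)) (h *: u)
             - f (p + s *: u))).
  apply/funext => h /=; congr (_ *: (f _ - _)).
  by rewrite [h *: 1]mulr1 scalerDl addrCA.
by apply: DeriveDef; rewrite /derivable /derive E.
Qed.
End MixedDerivatives.

Lemma MVT_derivable (R : realType) (f df : R -> R) (h : R) : 0 < h ->
  (forall t, t \in `[0, h] -> is_derive t 1 f (df t)) ->
  exists2 c, c \in `]0, h[ & f h - f 0 = h * df c.
Proof.
move=> h0 fd.
have fd' x : x \in `]0, h[%R -> is_derive x 1 f (df x).
  by move=> xh; apply: fd; exact: subset_itv_oo_cc.
have fc : {within `[0, h], continuous f}.
  by apply: derivable_within_continuous => x xh; have [] := fd x xh.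
have [c ch E] := MVT h0 fd' fc.
by exists c => //; rewrite E subr0 mulrC.
Qed.

(** The mean value theorem is used twice: along [u] for the increment of [f] in direction [v], then
    along [v] for ['D_u f]. The left side is symmetric in [u] and [v], which [derive_comm]
    exploits. *)
Lemma second_difference (R : realType) (V : normedModType R) (f : V -> R)
    (p u v : V) (h : R) : 0 < h ->
  (forall s t, s \in `[0, h] -> t \in `[0, h] ->
    derivable f (p + s *: u + t *: v) u /\
    derivable ('D_u f) (p + s *: u + t *: v) v) ->
  exists s, exists t, [/\ s \in `]0, h[, t \in `]0, h[ &
    f (p + h *: u + h *: v) - f (p + h *: v) - (f (p + h *: u) - f p) =
    h * (h * 'D_v ('D_u f) (p + s *: u + t *: v))].
Proof.
move=> h0 fd.
have h_in : h \in `[0, h] by rewrite in_itv /= lexx ltW.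
have o_in : 0 \in `[0, h] by rewrite in_itv /= lexx ltW.
have [s sh Es] : exists2 s, s \in `]0, h[ &
    f (p + h *: u + h *: v) - f (p + h *: v) - (f (p + h *: u) - f p) =
    h * ('D_u f (p + s *: u + h *: v) - 'D_u f (p + s *: u)).
  have [t t_in|s sh E] := @MVT_derivable R
    (fun s => f (p + h *: v + s *: u) - f (p + s *: u))
    (fun s => 'D_u f (p + h *: v + s *: u) - 'D_u f (p + s *: u)) h h0.
    apply: is_deriveB; apply: is_derive_line.
      by rewrite (addrAC p); exact: (fd t h t_in h_in).1.
    by have := (fd t 0 t_in o_in).1; rewrite scale0r addr0.
  exists s => //; rewrite [p + s *: u + _]addrAC -E !scale0r !addr0.
  by rewrite [p + h *: v + _]addrAC; ring.
have sh' := subset_itv_oo_cc sh.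
have [t t_in|t th E] := @MVT_derivable R
    (fun t => 'D_u f (p + s *: u + t *: v))
    (fun t => 'D_v ('D_u f) (p + s *: u + t *: v)) h h0.
  by apply: is_derive_line; have [] := fd _ _ sh' t_in.
by exists s, t; split => //; rewrite Es -E scale0r addr0.
Qed.

Lemma near_box (R : realType) (V : normedModType R) (p u v : V) (P : set V) :
  (\forall q \near p, P q) ->
  exists2 h : R, 0 < h & forall s t, s \in `[0, h] -> t \in `[0, h] ->
    P (p + s *: u + t *: v).
Proof.
move=> /nbhs_ballP[e /= e0 Pe].
have k0 : 0 < `|u| + `|v| + 1 by rewrite ltr_wpDl // addr_ge0.
(* The [+ 1] keeps the denominator positive when [u = v = 0]; the half makes the final bound
   strict. *)
exists (e / (`|u| + `|v| + 1) / 2); first by rewrite !divr_gt0.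
set h := e / _ / 2.
have hE : h * (`|u| + `|v| + 1) = e / 2.
  by rewrite /h mulrAC divfK // gt_eqF.
have h0 : 0 < h by rewrite !divr_gt0.
move=> s t; rewrite !in_itv /= => /andP[s0 sh] /andP[t0 th].
apply: Pe; rewrite -ball_normE /= opprD addrA opprD addrA subrr sub0r.
rewrite -opprD normrN; apply: (le_lt_trans (ler_normD _ _)).
rewrite !normrZ !ger0_norm //.
have : s * `|u| <= h * `|u| by apply: ler_wpM2r.
have : t * `|v| <= h * `|v| by apply: ler_wpM2r.
by nra.
Qed.

(** Schwarz's theorem. The same second difference is h^2 times a value of either mixed derivative at
    points near [p]; these two values are therefore equal, and continuity at [p] puts each mixed
    derivative at [p] within e/2 of the common value. *)
Lemma derive_comm (R : realType) (V : normedModType R) (f : V -> R)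
    (p u v : V) :
  (\forall q \near p, [/\ derivable f q u, derivable f q v,
     derivable ('D_u f) q v & derivable ('D_v f) q u]) ->
  {for p, continuous ('D_v ('D_u f))} ->
  {for p, continuous ('D_u ('D_v f))} ->
  'D_v ('D_u f) p = 'D_u ('D_v f) p.
Proof.
move=> fd c1 c2; apply/eqP; rewrite -subr_eq0 -normr_le0.
apply/ler_addgt0Pr => e e0; rewrite add0r.
have e2 : 0 < e / 2 by rewrite divr_gt0.
move/cvgrPdist_lt/(_ _ e2): c1 => c1; move/cvgrPdist_lt/(_ _ e2): c2 => c2.
have [h h0 /= H] := @near_box R V p u v _ (filterI fd (filterI c1 c2)).
have oc := @subset_itv_oo_cc _ R 0 h.
have [a d1 E1] : exists2 a, `|'D_v ('D_u f) p - a| < e / 2 &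
    f (p + h *: u + h *: v) - f (p + h *: v) - (f (p + h *: u) - f p) =
    h * (h * a).
  have [|s [t [sh th E]]] := @second_difference R V f p u v h h0.
    move=> s t sh th; have [[fu _ fuv _] _] := H s t sh th.
    by split; [exact: fu | exact: fuv].
  exists ('D_v ('D_u f) (p + s *: u + t *: v)); last exact: E.
  exact: (H s t (oc _ sh) (oc _ th)).2.1.
have [b d2 E2] : exists2 b, `|'D_u ('D_v f) p - b| < e / 2 &
    f (p + h *: v + h *: u) - f (p + h *: u) - (f (p + h *: v) - f p) =
    h * (h * b).
  have [|t [s [th sh E]]] := @second_difference R V f p v u h h0.
    move=> t s th sh; have [[_ fv _ fvu] _] := H s t sh th.
    by rewrite (addrAC p); split; [exact: fv | exact: fvu].
  exists ('D_u ('D_v f) (p + t *: v + s *: u)); last exact: E.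
  by rewrite (addrAC p); exact: (H s t (oc _ sh) (oc _ th)).2.2.
move: d1 d2; move: ('D_v _ p) ('D_u _ p) => x y d1 d2.
(* Both are the second difference divided by h^2. *)
have E : a = b.
  apply: (mulfI (lt0r_neq0 h0)); apply: (mulfI (lt0r_neq0 h0)).
  rewrite -E1 -E2 (addrAC p (h *: v)).
  by move: (f _) (f _) (f _) (f _) => *; ring.
rewrite -E distrC in d2.
rewrite (_ : x - y = x - a + (a - y)); last by ring.
by apply: (le_trans (ler_normD _ _)); rewrite (splitr e) lerD // ltW.
Qed.

(** * Directional derivatives of pointwise operations *)

Section PointwiseDerivatives.
Variables (R : numFieldType) (V : normedModType R).
Implicit Types (f g : V -> R) (p v : V).

Lemma is_derive_const (c : R) p v : is_derive p v (fun _ => c) 0.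
Proof. exact: is_derive_cst. Qed.

Lemma is_derive_add f g p v (df dg : R) :
  is_derive p v f df -> is_derive p v g dg ->
  is_derive p v (fun q => f q + g q) (df + dg).
Proof. by move=> fd gd; exact: is_deriveD. Qed.

Lemma is_derive_opp f p v (df : R) :
  is_derive p v f df -> is_derive p v (fun q => - f q) (- df).
Proof. by move=> fd; exact: is_deriveN. Qed.

Lemma is_derive_mul f g p v (df dg : R) :
  is_derive p v f df -> is_derive p v g dg ->
  is_derive p v (fun q => f q * g q) (df * g p + f p * dg).
Proof.
move=> fd gd; apply: is_derive_eq (is_deriveM _ _) _.
by rewrite addrC; congr (_ + _); exact: mulrC.
Qed.

Lemma is_derive_inv f p v (df : R) : f p != 0 ->
  is_derive p v f df -> is_derive p v (fun q => (f q)^-1) (- df / f p ^+ 2).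
Proof.
move=> fp [fd fE]; apply: DeriveDef; first exact: derivableV.
by rewrite deriveV // fE mulNr mulrC -mulNr.
Qed.

Lemma is_derive_bigsum n (F : 'I_n -> V -> R) p v (dF : 'I_n -> R) :
  (forall i, is_derive p v (F i) (dF i)) ->
  is_derive p v (fun q => \sum_(i < n) F i q) (\sum_(i < n) dF i).
Proof.
move=> Fd; rewrite (_ : (fun q => _) = \sum_(i < n) F i).
  exact: is_derive_sum.
by apply/funext => q; rewrite fct_sumE.
Qed.

End PointwiseDerivatives.

(** * Base and fibre coordinates *)

Section DeltaBlocks.
Variables (R : realType) (n : nat).

Lemma lsubmx_linear : linear (@lsubmx R 1 n n).
Proof. by move=> a u v; rewrite linearP. Qed.

Lemma rsubmx_linear : linear (@rsubmx R 1 n n).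
Proof. by move=> a u v; rewrite linearP. Qed.

Lemma coord_linear m (i : 'I_m) : linear (fun q : 'rV[R]_m => q 0 i : R).
Proof. by move=> a u v; rewrite !mxE. Qed.

Lemma lsubmx_delta_l (i : 'I_n) :
  lsubmx (delta_mx 0 (lshift n i) : 'rV[R]_(n + n)) = delta_mx 0 i.
Proof. by apply/rowP => j; rewrite !mxE eq_lshift. Qed.

Lemma lsubmx_delta_r (i : 'I_n) :
  lsubmx (delta_mx 0 (rshift n i) : 'rV[R]_(n + n)) = 0.
Proof. by apply/rowP => j; rewrite !mxE eq_lrshift andbF. Qed.

Lemma rsubmx_delta_l (i : 'I_n) :
  rsubmx (delta_mx 0 (lshift n i) : 'rV[R]_(n + n)) = 0.
Proof. by apply/rowP => j; rewrite !mxE eq_rlshift andbF. Qed.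

Lemma rsubmx_delta_r (i : 'I_n) :
  rsubmx (delta_mx 0 (rshift n i) : 'rV[R]_(n + n)) = delta_mx 0 i.
Proof. by apply/rowP => j; rewrite !mxE eq_rshift. Qed.

Lemma is_derive_base_l (F : 'rV[R]_n -> R) (p : 'rV[R]_(n + n)) i :
  derivable F (lsubmx p) (delta_mx 0 i) ->
  is_derive p (delta_mx 0 (lshift n i)) (fun q => F (lsubmx q))
    (partial i F (lsubmx p)).
Proof.
move=> Fd; apply: (is_derive_comp_linear _ _ _ _ _ F); first exact: lsubmx_linear.
by rewrite lsubmx_delta_l; exact: derivableP.
Qed.

(** A fibre direction projects to the zero vector, along which any function has derivative 0. Hence
    this also applies to the partial derivatives of [Pi], about whose regularity nothing is
    assumed. *)
Lemma is_derive_base_r (F : 'rV[R]_n -> R) (p : 'rV[R]_(n + n)) i :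
  is_derive p (delta_mx 0 (rshift n i)) (fun q => F (lsubmx q)) 0.
Proof.
apply: (is_derive_comp_linear _ _ _ _ _ F); first exact: lsubmx_linear.
by rewrite lsubmx_delta_r; exact: is_derive0.
Qed.

Lemma is_derive_coord m (p v : 'rV[R]_m) k :
  is_derive p v (fun q => q 0 k : R) (v 0 k).
Proof.
apply: (is_derive_comp_linear _ _ _ _ _ (@id R)).
exact: coord_linear.
Qed.

Lemma is_derive_fibre (p v : 'rV[R]_(n + n)) k :
  is_derive p v (fun q => rsubmx q 0 k : R) (rsubmx v 0 k).
Proof.
apply: (is_derive_comp_linear _ _ _ _ _ (fun q : 'rV[R]_n => q 0 k : R)).
  exact: rsubmx_linear.
exact: is_derive_coord.
Qed.

End DeltaBlocks.

(** * Deformed Riemann extensions *)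

Section DeformedExtension.
Variables (R : realType) (n : nat).
Variables (Pi : 'I_n -> 'I_n -> 'I_n -> 'rV[R]_n -> R) (C : 'M[R]_n).

Definition deformed_extension (p : 'rV[R]_(n + n)) : 'M[R]_(n + n) :=
  riemann_extension Pi p + block_mx C 0 0 0.
Local Notation g := deformed_extension.

Definition base_block (i j : 'I_n) (p : 'rV[R]_(n + n)) : R :=
  - 2 * (\sum_(k < n) Pi k i j (lsubmx p) * rsubmx p 0 k) + C i j.
Local Notation A := base_block.

(** The Christoffel symbol with upper fibre index and two lower base indices, as read off from the
    lower row [1, -A] of the inverse metric. It is affine in the fibre coordinates, and [C] enters
    only through [A]. *)
Definition christoffel_fibre (k i j : 'I_n) (p : 'rV[R]_(n + n)) : R :=
  \sum_(s < n) (partial k (Pi s i j) (lsubmx p) - partial i (Pi s k j) (lsubmx p)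
    - partial j (Pi s k i) (lsubmx p)) * rsubmx p 0 s
  - \sum_(m < n) A k m p * Pi m i j (lsubmx p).

(** The Ricci tensor of the connection [Pi], with the index conventions of [ricci]. As [Pi] need not
    come from a metric here, this tensor need not be symmetric. *)
Definition connection_ricci (i k : 'I_n) (q : 'rV[R]_n) : R :=
  \sum_(m < n) (partial m (Pi m k i) q - partial k (Pi m m i) q
  + \sum_(s < n) (Pi m m s q * Pi s k i q - Pi m k s q * Pi s m i q)).

Lemma deformed_extensionE p :
  g p = block_mx (\matrix_(i, j) A i j p) 1%:M 1%:M 0.
Proof.
rewrite /g /riemann_extension add_block_mx !addr0; congr block_mx.
by apply/matrixP => i j; rewrite !mxE.
Qed.

Lemma ext_ll p i j : g p (lshift n i) (lshift n j) = A i j p.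
Proof. by rewrite deformed_extensionE block_mxEul mxE. Qed.

Lemma ext_lr p i j : g p (lshift n i) (rshift n j) = (i == j)%:R.
Proof. by rewrite deformed_extensionE block_mxEur mxE. Qed.

Lemma ext_rl p i j : g p (rshift n i) (lshift n j) = (i == j)%:R.
Proof. by rewrite deformed_extensionE block_mxEdl mxE. Qed.

Lemma ext_rr p i j : g p (rshift n i) (rshift n j) = 0.
Proof. by rewrite deformed_extensionE block_mxEdr mxE. Qed.

(** * The inverse metric and the Christoffel symbols of the extension *)

Lemma invmx_ext p :
  invmx (g p) = block_mx 0 1%:M 1%:M (- \matrix_(i, j) A i j p).
Proof.
set B := block_mx 0 _ _ _.
have BA : B *m g p = 1%:M.
  rewrite deformed_extensionE mulmx_block !mul0mx !mul1mx !mulmx1 !mulmx0.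
  by rewrite !add0r addr0 addrN -scalar_mx_block.
have [_ gu] := mulmx1_unit BA.
by rewrite -[LHS]mul1mx -BA -mulmxA mulmxV // mulmx1.
Qed.

Lemma partial_rl a i j p :
  partial a (fun q => g q (rshift n i) (lshift n j)) p = 0.
Proof.
by under eq_fun do rewrite ext_rl; apply: derive_val; exact: is_derive_const.
Qed.

Lemma partial_lr a i j p :
  partial a (fun q => g q (lshift n i) (rshift n j)) p = 0.
Proof.
by under eq_fun do rewrite ext_lr; apply: derive_val; exact: is_derive_const.
Qed.

Lemma partial_rr a i j p :
  partial a (fun q => g q (rshift n i) (rshift n j)) p = 0.
Proof.
by under eq_fun do rewrite ext_rr; apply: derive_val; exact: is_derive_const.
Qed.

Lemma is_derive_A_r m i j p :
  is_derive p (delta_mx 0 (rshift n m)) (A i j) (- 2 * Pi m i j (lsubmx p)).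
Proof.
apply: is_derive_eq.
  apply: is_derive_add (is_derive_const _ _ _ _ _).
  apply: is_derive_mul (is_derive_const _ _ _ _ _) _.
  apply: is_derive_bigsum => k.
  by apply: is_derive_mul (is_derive_base_r _ _ _ _ _)
    (is_derive_fibre _ _ _ _ _).
rewrite mul0r add0r addr0; congr (_ * _); rewrite (bigD1 m) //= big1 => [|k km].
  by rewrite mul0r add0r rsubmx_delta_r mxE !eqxx mulr1 addr0.
by rewrite mul0r add0r rsubmx_delta_r mxE (negPf km) andbF mulr0.
Qed.

Lemma partial_ll_r m i j p :
  partial (rshift n m) (fun q => g q (lshift n i) (lshift n j)) p =
  - 2 * Pi m i j (lsubmx p).
Proof.
under eq_fun do rewrite ext_ll.
exact/derive_val/is_derive_A_r.
Qed.

Lemma partial_ll_l m i j p :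
  (forall k, derivable (Pi k i j) (lsubmx p) (delta_mx 0 m)) ->
  partial (lshift n m) (fun q => g q (lshift n i) (lshift n j)) p =
  - 2 * \sum_(k < n) partial m (Pi k i j) (lsubmx p) * rsubmx p 0 k.
Proof.
move=> Pd; under eq_fun do rewrite ext_ll.
apply: derive_val; apply: is_derive_eq.
  apply: is_derive_add (is_derive_const _ _ _ _ _).
  apply: is_derive_mul (is_derive_const _ _ _ _ _) _.
  apply: is_derive_bigsum => k.
  by apply: is_derive_mul (is_derive_base_l _ _ _ _ _ (Pd k))
    (is_derive_fibre _ _ _ _ _).
rewrite mul0r add0r addr0; congr (_ * _); apply: eq_bigr => k _.
by rewrite rsubmx_delta_l [X in _ + _ * X]mxE mulr0 addr0.
Qed.

(** The upper row [0, 1] of the inverse selects the fibre index [k], and metric entries with a fibre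
    index are constant, so one of the three derivatives remains. *)
Lemma christoffel_l k a b p : christoffel g (lshift n k) a b p =
  - 2^-1 * partial (rshift n k) (fun q => g q a b) p.
Proof.
rewrite /christoffel invmx_ext.
rewrite big_split_ord /=.
rewrite [X in X + _]big1 => [|m _]; last first.
  by rewrite block_mxEul mxE mul0r.
rewrite add0r (bigD1 k) //= big1 => [|m mk]; last first.
  by rewrite block_mxEur mxE eq_sym (negPf mk) mul0r.
rewrite block_mxEur mxE eqxx mul1r addr0.
have Z c d : partial c (fun q => g q (rshift n k) d) p = 0.
  by case: (split_ordP d) => j ->; rewrite (partial_rl, partial_rr).
by rewrite !Z !add0r mulrN mulNr.
Qed.

Lemma christoffel_lll k i j p :
  christoffel g (lshift n k) (lshift n i) (lshift n j) p = Pi k i j (lsubmx p).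
Proof. by rewrite christoffel_l partial_ll_r; field. Qed.

Lemma christoffel_llr k i j p :
  christoffel g (lshift n k) (lshift n i) (rshift n j) p = 0.
Proof. by rewrite christoffel_l partial_lr mulr0. Qed.

Lemma christoffel_lrl k i j p :
  christoffel g (lshift n k) (rshift n i) (lshift n j) p = 0.
Proof. by rewrite christoffel_l partial_rl mulr0. Qed.

Lemma christoffel_lrr k i j p :
  christoffel g (lshift n k) (rshift n i) (rshift n j) p = 0.
Proof. by rewrite christoffel_l partial_rr mulr0. Qed.

(** From the lower row [1, -A] of the inverse: the 1 gives the symbol of the first kind, and the -A
    recombines into symbols with upper base index by [christoffel_l]. *)
Lemma christoffel_r k a b p : christoffel g (rshift n k) a b p =
  2^-1 * (partial a (fun q => g q (lshift n k) b) p
        + partial b (fun q => g q (lshift n k) a) p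
        - partial (lshift n k) (fun q => g q a b) p)
  - \sum_(m < n) A k m p * christoffel g (lshift n m) a b p.
Proof.
rewrite {1}/christoffel invmx_ext.
rewrite big_split_ord /= mulrDr; congr (_ + _).
  rewrite (bigD1 k) //= big1 => [|m mk]; last first.
    by rewrite block_mxEdl mxE eq_sym (negPf mk) mul0r.
  by rewrite block_mxEdl mxE eqxx mul1r addr0.
rewrite mulr_sumr -sumrN; apply: eq_bigr => m _.
rewrite block_mxEdr !mxE christoffel_l.
have Z c d : partial c (fun q => g q (rshift n m) d) p = 0.
  by case: (split_ordP d) => j ->; rewrite (partial_rl, partial_rr).
by rewrite !Z; ring.
Qed.

Lemma christoffel_rlr k i j p :
  christoffel g (rshift n k) (lshift n i) (rshift n j) p = - Pi j k i (lsubmx p).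
Proof.
rewrite christoffel_r big1 => [|m _]; last by rewrite christoffel_llr mulr0.
by rewrite !partial_lr partial_ll_r; field.
Qed.

Lemma christoffel_rrl k i j p :
  christoffel g (rshift n k) (rshift n i) (lshift n j) p = - Pi i k j (lsubmx p).
Proof.
rewrite christoffel_r big1 => [|m _]; last by rewrite christoffel_lrl mulr0.
by rewrite !partial_lr partial_rl partial_ll_r; field.
Qed.

Lemma christoffel_rrr k i j p :
  christoffel g (rshift n k) (rshift n i) (rshift n j) p = 0.
Proof.
rewrite christoffel_r big1 => [|m _]; last by rewrite christoffel_lrr mulr0.
by rewrite !partial_lr partial_rr; field.
Qed.

Lemma christoffel_rll k i j p :
  (forall s a b m, derivable (Pi s a b) (lsubmx p) (delta_mx 0 m)) ->
  christoffel g (rshift n k) (lshift n i) (lshift n j) p =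
  christoffel_fibre k i j p.
Proof.
move=> Pd; rewrite christoffel_r /christoffel_fibre; congr (_ - _); last first.
  by apply: eq_bigr => m _; rewrite christoffel_lll.
rewrite !partial_ll_l //.
under [RHS]eq_bigr do rewrite !mulrBl.
by rewrite !sumrB; field.
Qed.
(** Being constant, [C] contributes to [christoffel_fibre] only terms free of the fibre coordinates,
    so it drops out here. This is how the deformation disappears from the Ricci tensor. *)
Lemma is_derive_christoffel_fibre m k i j p :
  is_derive p (delta_mx 0 (rshift n m)) (christoffel_fibre k i j)
    (partial k (Pi m i j) (lsubmx p) - partial i (Pi m k j) (lsubmx p)
     - partial j (Pi m k i) (lsubmx p)
     + 2 * \sum_(s < n) Pi m k s (lsubmx p) * Pi s i j (lsubmx p)).
Proof.
apply: is_derive_eq.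
  apply: is_derive_add.
    apply: is_derive_bigsum => s.
    apply: is_derive_mul (is_derive_fibre _ _ _ _ _).
    exact: (is_derive_base_r _ _ (fun q => partial k (Pi s i j) q
      - partial i (Pi s k j) q - partial j (Pi s k i) q)).
  apply: is_derive_opp; apply: is_derive_bigsum => s.
  exact: is_derive_mul (is_derive_A_r _ _ _ _) (is_derive_base_r _ _ _ _ _).
congr (_ + _).
  rewrite (bigD1 m) //= big1 => [|s sm].
    by rewrite mul0r add0r rsubmx_delta_r mxE !eqxx mulr1 addr0.
  by rewrite mul0r add0r rsubmx_delta_r mxE (negPf sm) andbF mulr0.
rewrite mulr_sumr -sumrN; apply: eq_bigr => s _.
by rewrite mulr0 addr0; ring.
Qed.

Lemma partial_r_lll m k i j p :
  partial (rshift n m) (christoffel g (lshift n k) (lshift n i) (lshift n j)) p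
  = 0.
Proof.
rewrite (funext (christoffel_lll k i j)).
by apply: derive_val; exact: is_derive_base_r.
Qed.

Lemma partial_r_rrl m k i j p :
  partial (rshift n m) (christoffel g (rshift n k) (rshift n i) (lshift n j)) p
  = 0.
Proof.
rewrite (funext (christoffel_rrl k i j)) -[RHS]oppr0.
by apply: derive_val; apply: is_derive_opp; exact: is_derive_base_r.
Qed.

Lemma partial_r_rlr m k i j p :
  partial (rshift n m) (christoffel g (rshift n k) (lshift n i) (rshift n j)) p
  = 0.
Proof.
rewrite (funext (christoffel_rlr k i j)) -[RHS]oppr0.
by apply: derive_val; apply: is_derive_opp; exact: is_derive_base_r.
Qed.

Lemma partial_christoffel0 a k i j p :
  (forall q, christoffel g k i j q = 0) -> partial a (christoffel g k i j) p = 0.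
Proof.
move=> /funext ->; apply: derive_val; exact: is_derive_const.
Qed.

(** * The Ricci blocks with a fibre index *)

Definition christoffel0E := (christoffel_llr, christoffel_lrl, christoffel_lrr,
  christoffel_rrr).

(** Used where every term vanishes separately. Count lower minus upper fibre indices: symbols with
    positive count vanish, those with count 0 are independent of the fibre. In a Ricci component
    with a fibre index the total count is positive, so each product has a factor 0, and each
    derivative is of a zero symbol or is a fibre derivative of a symbol with count 0. *)
Lemma riemann_up_eq0 m j k l p :
  partial k (christoffel g m l j) p = 0 ->
  partial l (christoffel g m k j) p = 0 ->
  (forall s, christoffel g m k s p * christoffel g s l j p = 0) ->
  (forall s, christoffel g m l s p * christoffel g s k j p = 0) ->
  riemann_up g m j k l p = 0.
Proof.
move=> k0 l0 kl lk; rewrite /riemann_up k0 l0 subr0 add0r.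
by apply: big1 => s _; rewrite kl lk subr0.
Qed.

Lemma ricci_lr i k p : ricci g (lshift n i) (rshift n k) p = 0.
Proof.
apply: big1 => m _; apply: riemann_up_eq0 => [||s|s].
- case: (split_ordP m) => t ->; last exact: partial_r_rrl.
  by apply: partial_christoffel0; exact: christoffel_lrl.
- by case: (split_ordP m) => t ->; [exact: partial_r_lll | exact: partial_r_rrl].
- case: (split_ordP s) => t ->; first by rewrite christoffel_lrl mulr0.
  by case: (split_ordP m) => r ->; rewrite christoffel0E mul0r.
- case: (split_ordP m) => r ->; case: (split_ordP s) => t ->;
  by rewrite !christoffel0E (mul0r, mulr0).
Qed.

Lemma ricci_rl i k p : ricci g (rshift n i) (lshift n k) p = 0.
Proof.
apply: big1 => m _; apply: riemann_up_eq0 => [||s|s].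
- case: (split_ordP m) => t ->; last exact: partial_r_rlr.
  by apply: partial_christoffel0; exact: christoffel_llr.
- case: (split_ordP m) => t ->; apply: partial_christoffel0.
    exact: christoffel_llr.
  exact: christoffel_rrr.
- case: (split_ordP s) => t ->; first by rewrite christoffel_llr mulr0.
  by case: (split_ordP m) => r ->; rewrite christoffel0E mul0r.
- case: (split_ordP m) => r ->; case: (split_ordP s) => t ->;
  by rewrite !christoffel0E (mul0r, mulr0).
Qed.

Lemma ricci_rr i k p : ricci g (rshift n i) (rshift n k) p = 0.
Proof.
have Z c : forall q, christoffel g c (rshift n k) (rshift n i) q = 0.
  by move=> q; case: (split_ordP c) => t ->; rewrite christoffel0E.
apply: big1 => m _; apply: riemann_up_eq0 => [||s|s].
- exact: partial_christoffel0.
- case: (split_ordP m) => t ->; apply: partial_christoffel0.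
    exact: christoffel_llr.
  exact: christoffel_rrr.
- by rewrite Z mulr0.
- case: (split_ordP m) => r ->; case: (split_ordP s) => t ->;
  by rewrite !christoffel0E (mul0r, mulr0).
Qed.

(** * The base block of the Ricci tensor *)

Section Ricci.
Hypothesis PiC : forall k i j, Pi k i j = Pi k j i.

Lemma christoffel_fibreC k i j p :
  christoffel_fibre k i j p = christoffel_fibre k j i p.
Proof.
rewrite /christoffel_fibre; congr (_ - _); apply: eq_bigr => s _;
  rewrite (PiC s i j) //; ring.
Qed.

Variable Omega : set 'rV[R]_(n + n).
Hypothesis openOmega : open Omega.
Hypothesis Pi_derivable : forall p, Omega p -> forall s a b m,
  derivable (Pi s a b) (lsubmx p) (delta_mx 0 m).

Lemma partial_lll m k i j p : Omega p ->
  partial (lshift n m) (christoffel g (lshift n k) (lshift n i) (lshift n j)) p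
  = partial m (Pi k i j) (lsubmx p).
Proof.
move=> Op; rewrite (funext (christoffel_lll k i j)).
by apply: derive_val; apply: is_derive_base_l; exact: Pi_derivable.
Qed.

Lemma partial_rrl m k i j p : Omega p ->
  partial (lshift n m) (christoffel g (rshift n k) (rshift n i) (lshift n j)) p
  = - partial m (Pi i k j) (lsubmx p).
Proof.
move=> Op; rewrite (funext (christoffel_rrl k i j)).
apply: derive_val; apply: is_derive_opp.
by apply: is_derive_base_l; exact: Pi_derivable.
Qed.

(** The formula needs [Pi] derivable at the point; openness of [Omega] makes it hold nearby, so that
    it can be differentiated. *)
Lemma near_christoffel_rll k i j p : Omega p ->
  \forall q \near p, christoffel_fibre k i j q =
    christoffel g (rshift n k) (lshift n i) (lshift n j) q.
Proof.
move=> Op; near=> q; rewrite christoffel_rll //.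
apply: Pi_derivable; near: q; exact: open_nbhs_nbhs.
Unshelve. all: by end_near. Qed.

Lemma partial_r_rll m k i j p : Omega p ->
  partial (rshift n m) (christoffel g (rshift n k) (lshift n i) (lshift n j)) p
  = partial k (Pi m i j) (lsubmx p) - partial i (Pi m k j) (lsubmx p)
     - partial j (Pi m k i) (lsubmx p)
     + 2 * \sum_(s < n) Pi m k s (lsubmx p) * Pi s i j (lsubmx p).
Proof.
move=> Op; apply: derive_val.
exact: near_eq_is_derive (near_christoffel_rll _ _ _ _ Op)
  (is_derive_christoffel_fibre _ _ _ _ _).
Qed.

(** The trace splits over the contracted index: base values give the Ricci tensor of [Pi], fibre
    values its transpose, since [Pi] is symmetric in its lower indices. *)
Lemma ricci_ll i k p : Omega p ->
  ricci g (lshift n i) (lshift n k) p =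
  connection_ricci i k (lsubmx p) + connection_ricci k i (lsubmx p).
Proof.
move=> Op; rewrite /ricci big_split_ord /=; congr (_ + _).
  apply: eq_bigr => m _; rewrite /riemann_up !partial_lll //; congr (_ + _).
  rewrite big_split_ord /= [X in _ + X]big1 ?addr0 => [|s _].
    by apply: eq_bigr => s _; rewrite !christoffel_lll.
  by rewrite !christoffel_llr !mul0r subrr.
apply: eq_bigr => m _.
rewrite /riemann_up partial_r_rll // partial_rrl // big_split_ord /=.
(* [S] occurs twice through the fibre derivative and once, negated, through the products with [s] in
   the base. The single copy left is the first product of the transposed Ricci tensor; the second
   comes from [s] in the fibre. *)
set S := \sum_(s < n) _ * _.
rewrite [X in _ + (X + _)](_ : _ = - S); last first.
  rewrite -sumrN; apply: eq_bigr => s _.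
  by rewrite christoffel_rrl christoffel_lll christoffel_lrl mulr0 subr0 mulNr.
rewrite [\sum_(s < n) (Pi m m s _ * _ - _)](_ : _ =
  S + \sum_(s < n) (christoffel g (rshift n m) (rshift n m) (rshift n s) p *
    christoffel g (rshift n s) (lshift n k) (lshift n i) p -
  christoffel g (rshift n m) (lshift n k) (rshift n s) p *
    christoffel g (rshift n s) (rshift n m) (lshift n i) p)); last first.
  rewrite -big_split; apply: eq_bigr => s _ /=.
  rewrite christoffel_rrr christoffel_rlr christoffel_rrl.
  by rewrite (PiC s i k) (PiC m i s) (PiC s m k); ring.
rewrite (PiC m k i) (PiC m m i) (PiC m m k).
move: (\sum_(s < n) _) => T.
ring.
Qed.
End Ricci.
End DeformedExtension.

Arguments deformed_extension {R n}.
Arguments base_block {R n}.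
Arguments christoffel_fibre {R n}.
Arguments connection_ricci {R n}.

(** * The three-dimensional metric *)

(** Closed ordinals, so that lookups by [nth] in the tables below reduce by computation. *)
Definition o0 : 'I_3 := @Ordinal 3 0 isT.
Definition o1 : 'I_3 := @Ordinal 3 1 isT.
Definition o2 : 'I_3 := @Ordinal 3 2 isT.

Lemma ord3P (P : 'I_3 -> Prop) : P o0 -> P o1 -> P o2 -> forall i, P i.
Proof.
by move=> P0 P1 P2 [[|[|[|//]]] i3];
  [move: P0 | move: P1 | move: P2]; congr P; apply: val_inj.
Qed.

Lemma sum_ord3 (R : nmodType) (F : 'I_3 -> R) :
  \sum_(i < 3) F i = F o0 + F o1 + F o2.
Proof.
rewrite !big_ord_recl big_ord0 addr0 addrA.
by congr (F _ + F _ + F _); apply: val_inj.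
Qed.

(* Unlike [is_derive], not a type class: instance resolution would otherwise
   fill in the derivative before the goal is decomposed. *)
Definition has_partial {R : realType} {n : nat} (i : 'I_n) (f : 'rV[R]_n -> R)
    (p : 'rV[R]_n) (d : R) : Prop := is_derive p (delta_mx 0 i) f d.

Section HasPartial.
Variables (R : realType) (n : nat) (i : 'I_n).
Implicit Types (f g : 'rV[R]_n -> R) (p : 'rV[R]_n).

Lemma has_partial_const (c : R) p : has_partial i (fun _ => c) p 0.
Proof. exact: is_derive_const. Qed.

Lemma has_partial_add f g p (df dg : R) :
  has_partial i f p df -> has_partial i g p dg ->
  has_partial i (fun q => f q + g q) p (df + dg).
Proof. exact: is_derive_add. Qed.

Lemma has_partial_opp f p (df : R) :
  has_partial i f p df -> has_partial i (fun q => - f q) p (- df).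
Proof. exact: is_derive_opp. Qed.

Lemma has_partial_mul f g p (df dg : R) :
  has_partial i f p df -> has_partial i g p dg ->
  has_partial i (fun q => f q * g q) p (df * g p + f p * dg).
Proof. exact: is_derive_mul. Qed.

Lemma has_partial_base f (p : 'rV[R]_(n + n)) (d : R) :
  has_partial i f (lsubmx p) d ->
  has_partial (lshift n i) (fun q => f (lsubmx q)) p d.
Proof.
move=> fd; apply: is_derive_comp_linear; first exact: lsubmx_linear.
by rewrite lsubmx_delta_l.
Qed.

Lemma has_partial_fibre (p : 'rV[R]_(n + n)) k :
  has_partial (lshift n i) (fun q => rsubmx q 0 k : R) p 0.
Proof.
apply: is_derive_eq; first exact: is_derive_fibre.
by rewrite rsubmx_delta_l mxE.
Qed.

Lemma partialP f p (d c : R) : has_partial i f p d -> d = c -> partial i f p = c.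
Proof. by move=> fd <-; exact: derive_val. Qed.

Lemma has_partial_eq f p (d c : R) :
  has_partial i f p d -> d = c -> has_partial i f p c.
Proof. by move=> fd <-. Qed.

Lemma has_partial_near f g p (d : R) :
  (\forall q \near p, f q = g q) -> has_partial i f p d -> has_partial i g p d.
Proof. exact: near_eq_is_derive. Qed.
End HasPartial.

Lemma christoffel_sym (R : realType) n (g : 'rV[R]_n -> 'M[R]_n) :
  (forall q i j, g q i j = g q j i) ->
  forall k i j, christoffel g k i j = christoffel g k j i.
Proof.
move=> gC k i j; apply/funext => p; rewrite /christoffel; congr (_ * _).
apply: eq_bigr => m _; congr (_ * (_ - _)); first exact: addrC.
by congr (partial m _ p); apply/funext => q; exact: gC.
Qed.

Section KdVMetric.
Variables (R : realType) (D : set 'rV[R]_2) (l : 'rV[R]_2 -> R).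
Hypothesis openD : open D.
Hypothesis smooth_l : smooth_on D l.

Definition domain3 : set 'rV[R]_3 := [set q | D (proj_xz q) /\ q 0 1 != 0].

(* The head of [s] is the derivative taken last. *)
Definition jet (s : seq 'I_2) (q : 'rV[R]_3) : R := iter_partial s l (proj_xz q).

Definition jet_partial (s : seq 'I_2) (d : nat) (q : 'rV[R]_3) : R :=
  nth 0 [:: jet (0 :: s) q; 0; jet (1 :: s) q] d.

Lemma proj_xz_linear : linear (@proj_xz R).
Proof.
move=> a u v; apply/rowP => j; rewrite /proj_xz !mxE.
by case: j => -[|[|//]] ?.
Qed.

Lemma has_partial_jet s q d : domain3 q ->
  has_partial d (jet s) q (jet_partial s d q).
Proof.
move=> [Dq _].
apply: (is_derive_comp_linear _ _ _ _ _ (iter_partial s l)).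
  exact: proj_xz_linear.
have [_ ld] := smooth_l s _ Dq.
elim/ord3P: d.
- rewrite (_ : proj_xz (delta_mx _ _) = delta_mx 0 0).
    by apply: DeriveDef => //; exact: ld.
  by apply/rowP => -[[|[|//]] ?]; rewrite /proj_xz !mxE.
- rewrite (_ : proj_xz (delta_mx _ _) = 0); first exact: is_derive0.
  by apply/rowP => -[[|[|//]] ?]; rewrite /proj_xz !mxE.
- rewrite (_ : proj_xz (delta_mx _ _) = delta_mx 0 1).
    by apply: DeriveDef => //; exact: ld.
  by apply/rowP => -[[|[|//]] ?]; rewrite /proj_xz !mxE.
Qed.

Lemma has_partial_y (q : 'rV[R]_3) d :
  has_partial d (fun q => q 0 1 : R) q (nth 0 [:: 0; 1; 0] d).
Proof.
apply: is_derive_eq; first exact: is_derive_coord.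
by elim/ord3P: d; rewrite mxE.
Qed.

Lemma has_partial_yV (q : 'rV[R]_3) d : domain3 q ->
  has_partial d (fun q => (q 0 1)^-1 : R) q
    (- (nth 0 [:: 0; 1; 0] d) / (q 0 1) ^+ 2).
Proof. by move=> [_ q1]; apply: is_derive_inv q1 _; exact: has_partial_y. Qed.

Lemma open_domain3 : open domain3.
Proof.
rewrite openE => q [Dq q1].
have /nbhs_ballP[e /= e0 De] := openD _ Dq.
(* The bound [e] keeps the projection in [D]; the bound |y| keeps the second coordinate away from
   0. *)
have e'0 : 0 < Num.min e `|q 0 1| by rewrite lt_min e0 normr_gt0.
apply/nbhs_ballP; exists (Num.min e `|q 0 1|) => //= r [_ qr].
have qr' j : `|q 0 j - r 0 j| < e /\ `|q 0 j - r 0 j| < `|q 0 1|.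
  by have := qr 0 j; rewrite /ball /= lt_min => /andP.
split.
  apply: De; split=> // i j; rewrite /proj_xz /ball /= !mxE.
  by case: j => -[|[|//]] ?; [exact: (qr' 0).1 | exact: (qr' 2).1].
apply/eqP => r0; have [_] := qr' 1.
by rewrite r0 subr0 ltxx.
Qed.

Definition metric3_partial (d i j : nat) (q : 'rV[R]_3) : R :=
  let y := q 0 1 in
  let L := jet [::] q in let Lx := jet [:: 0] q in
  let dy := nth 0 [:: 0; 1; 0] d in
  let dL := jet_partial [::] d q in let dLx := jet_partial [:: 0] d q in
  let b := 2 * y * dy * L + y ^+ 2 * dL in
  nth 0 (nth [::]
    [:: [:: 2 * y * dy; 0; b];
        [:: 0; 0; 0];
        [:: b; 0; 2 * y * dy * L ^+ 2 + 2 * y ^+ 2 * L * dL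
                  - 2 * dy * Lx - 2 * y * dLx + dL]] i) j.

Definition metric3_inv (i j : nat) (q : 'rV[R]_3) : R :=
  let y := q 0 1 in
  let L := jet [::] q in let Lx := jet [:: 0] q in
  let c := - L + 2^-1 * y^-1 ^+ 2 in
  nth 0 (nth [::]
    [:: [:: y^-1 ^+ 2; c; 0];
        [:: c; 2 * y * Lx - 2 * L + 4^-1 * y^-1 ^+ 2; 1];
        [:: 0; 1; 0]] i) j.

(** One 3 x 3 table per upper index [k]. Powers are spelled out as products and quotients as
    products with y^-1, the shapes that [has_partial_jets] can differentiate. *)
Definition christoffel3 (k i j : nat) (q : 'rV[R]_3) : R :=
  let y := q 0 1 in let z := (q 0 1)^-1 in
  let L := jet [::] q in let Lx := jet [:: 0] q in
  let Lxx := jet [:: 0; 0] q in let Lz := jet [:: 1] q in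
  let Lzx := jet [:: 1; 0] q in
  nth 0 (nth [::] (nth [::]
  [:: [:: [:: L * y - 2^-1 * z; z; L * L * y - 2^-1 * L * z];
          [:: z; 0; L * z];
          [:: L * L * y - 2^-1 * L * z; L * z;
              Lz - 2 * L * Lx + Lxx * z + L * L * L * y - 2^-1 * L * L * z]];
      [:: [:: - Lx * y * y + 2 * L * y - 4^-1 * z; 2^-1 * z;
              - L * Lx * y * y + 2 * L * L * y - 4^-1 * L * z - Lxx * y
              + 2^-1 * Lx];
          [:: 2^-1 * z; 0; 2^-1 * L * z - Lx];
          [:: - L * Lx * y * y + 2 * L * L * y - 4^-1 * L * z - Lxx * y
              + 2^-1 * Lx; 2^-1 * L * z - Lx;
              - L * L * Lx * y * y - L * Lxx * y + Lz + 2^-1 * Lxx * z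
              + 2 * Lx * Lx * y + 2 * L * L * L * y - 2 * L * Lx
              - 4^-1 * L * L * z - Lzx * y]];
      [:: [:: - y; 0; - L * y]; [:: 0; 0; 0];
          [:: - L * y; 0; - L * L * y + Lx]]] k) i) j.

(** Restates the entries with products in place of squares, for [has_partial_jets]. *)
Lemma metric3_entry i j q : metric3 l q i j =
  let y := q 0 1 in let L := jet [::] q in let Lx := jet [:: 0] q in
  nth 0 (nth [::]
    [:: [:: y * y; 0; y * y * L - 2^-1]; [:: 0; 0; 1];
        [:: y * y * L - 2^-1; 1; y * y * (L * L) - 2 * y * Lx + L]] i) j.
Proof. by rewrite mxE. Qed.

(** Syntactic differentiation: the derivative is an existential variable, filled in by following the
    structure of the expression. *)
Ltac has_partial_jets :=
  first [ eapply has_partial_const | simple apply has_partial_y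
    | eapply has_partial_yV; assumption
    | eapply has_partial_jet; assumption
    | eapply has_partial_mul; has_partial_jets
    | eapply has_partial_add; has_partial_jets
    | eapply has_partial_opp; has_partial_jets ].

Lemma partial_metric3 d i j q : domain3 q ->
  partial d (fun q => metric3 l q i j) q = metric3_partial d i j q.
Proof.
move=> Bq; under eq_fun do rewrite metric3_entry.
move: d; elim/ord3P: i; elim/ord3P: j; rewrite /metric3_partial /= => d;
  (eapply partialP; [has_partial_jets | lazy beta; ring]).
Qed.

(** The determinant of the metric is -y^2, so it is invertible where y is nonzero; the table is
    checked as a right inverse. *)
Lemma invmx_metric3 i j q : domain3 q ->
  invmx (metric3 l q) i j = metric3_inv i j q.
Proof.
move=> [_ q1].
have E : metric3 l q *m (\matrix_(i, j) metric3_inv i j q) = 1%:M.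
  apply/matrixP => a b; rewrite !mxE sum_ord3 !metric3_entry !mxE.
  elim/ord3P: a; elim/ord3P: b; rewrite /metric3_inv /=; by field.
have [u _] := mulmx1_unit E.
by rewrite -[invmx _]mulmx1 -E mulmxA mulVmx // mul1mx mxE.
Qed.

Lemma christoffel_metric3 k i j q : domain3 q ->
  christoffel (metric3 l) k i j q = christoffel3 k i j q.
Proof.
move=> Bq; rewrite /christoffel sum_ord3 !invmx_metric3 // !partial_metric3 //.
have [_ q1] := Bq.
rewrite /metric3_partial /metric3_inv /christoffel3 /jet_partial /=.
(* [field] would try to identify distinct jets by unfolding them to limits. *)
move: (jet [:: 1; 0] q) (jet [:: 0; 0] q) (jet [:: 1] q) (jet [:: 0] q)
  (jet [::] q) => Lzx Lxx Lz Lx L.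
move: (q 0 1) q1 => y y0.
elim/ord3P: k; elim/ord3P: i; elim/ord3P: j => /=; by field.
Qed.

Lemma near_christoffel3 (k i j : 'I_3) q : domain3 q ->
  \forall r \near q, christoffel3 k i j r = christoffel (metric3 l) k i j r.
Proof.
move=> Bq.
have : \forall r \near q, domain3 r.
  exact: (open_nbhs_nbhs (conj open_domain3 Bq)).
by apply: filterS => r Br; rewrite christoffel_metric3.
Qed.

Lemma partial_christoffel d (k i j : 'I_3) q c : domain3 q ->
  has_partial d (christoffel3 k i j) q c ->
  partial d (christoffel (metric3 l) k i j) q = c.
Proof.
move=> Bq Gd; apply: partialP erefl.
exact: has_partial_near (near_christoffel3 _ _ _ _ Bq) Gd.
Qed.

Lemma derivable_christoffel d k i j q : domain3 q ->
  derivable (christoffel (metric3 l) k i j) q (delta_mx 0 d).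
Proof.
move=> Bq.
suff [c Gd] : exists c, has_partial d (christoffel3 k i j) q c.
  have := has_partial_near _ _ _ _ _ _ _ (near_christoffel3 _ _ _ _ Bq) Gd.
  by case.
elim/ord3P: k; elim/ord3P: i; elim/ord3P: j; rewrite /christoffel3 /=;
  eexists; has_partial_jets.
Qed.

(** The Ricci tensor meets l_xz in both orders: from differentiating l_z in x, and from l_x in z. *)
Lemma jet_comm q : domain3 q -> jet [:: 0; 1] q = jet [:: 1; 0] q.
Proof.
move=> [Dq _]; have cont s := (smooth_l s _ Dq).1.
apply: derive_comm; [|exact: (cont [:: 0; 1])|exact: (cont [:: 1; 0])].
have : \forall r \near proj_xz q, D r by exact: open_nbhs_nbhs.
apply: filterS => r Dr; split.
- exact: (smooth_l [::] _ Dr).2.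
- exact: (smooth_l [::] _ Dr).2.
- exact: (smooth_l [:: 1] _ Dr).2.
- exact: (smooth_l [:: 0] _ Dr).2.
Qed.

(** Trades each derivative of a Christoffel symbol for that of its table entry, computed by
    [has_partial_jets]. *)
Ltac eval_partials Bq :=
  repeat match goal with
  | |- context [partial ?d (christoffel _ ?k ?i ?j) ?q] =>
    let H := fresh in
    eassert (H : has_partial d (christoffel3 k i j) q _);
      [rewrite /christoffel3 /=; has_partial_jets |];
    rewrite (partial_christoffel _ _ _ _ _ _ Bq H); clear H
  end.

Lemma connection_ricci_metric3 i k q : domain3 q -> kdv_equation l (proj_xz q) ->
  connection_ricci (christoffel (metric3 l)) i k q = 0.
Proof.
move=> Bq kdv; have [_ q1] := Bq.
have {}kdv : jet [:: 1] q - 3 * jet [::] q * jet [:: 0] q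
             + jet [:: 0; 0; 0] q = 0 by exact: kdv.
have comm := jet_comm _ Bq.
have GE k' i' j' := christoffel_metric3 k' i' j' _ Bq.
rewrite /connection_ricci !sum_ord3 !GE.
elim/ord3P: i; elim/ord3P: k.
all: eval_partials Bq.
all: rewrite /jet_partial /christoffel3 /= ?comm.
all: move: kdv; clear comm GE;
  move: (jet [:: 0; 0; 0] q) (jet [:: 1; 0] q) (jet [:: 0; 0] q) (jet [:: 1] q)
  (jet [:: 0] q) (jet [::] q) => Lxxx Lzx Lxx Lz Lx L kdv;
  move: (q 0 1) q1 => y y0.
(* The ninth case is i = k = z, the one component that needs the differential equation; the other
   eight vanish identically. *)
9: transitivity (y^-1 * (Lz - 3 * L * Lx + Lxxx));
  last by rewrite kdv mulr0.
all: by field.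
Qed.

Lemma metric3_sym q i j : metric3 l q i j = metric3 l q j i.
Proof. by rewrite !metric3_entry; elim/ord3P: i; elim/ord3P: j. Qed.

Lemma has_partial_jet_base s (p : 'rV[R]_(3 + 3)) d : domain3 (lsubmx p) ->
  has_partial (lshift 3 d) (fun q => jet s (lsubmx q)) p
    (jet_partial s d (lsubmx p)).
Proof. by move=> Bp; apply: has_partial_base; exact: has_partial_jet. Qed.

Lemma has_partial_yV_base (p : 'rV[R]_(3 + 3)) d : domain3 (lsubmx p) ->
  has_partial (lshift 3 d) (fun q => (lsubmx q 0 1)^-1 : R) p
    (- (nth 0 [:: 0; 1; 0] d) / (lsubmx p 0 1) ^+ 2).
Proof.
move=> Bp; apply: (has_partial_base _ _ _ (fun q : 'rV[R]_3 => (q 0 1)^-1)).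
exact: has_partial_yV.
Qed.

Ltac has_partial_base_jets :=
  first [ eapply has_partial_const | eapply has_partial_fibre
    | eapply has_partial_yV_base; assumption
    | eapply has_partial_jet_base; assumption
    | eapply has_partial_mul; has_partial_base_jets
    | eapply has_partial_add; has_partial_base_jets
    | eapply has_partial_opp; has_partial_base_jets ].

(** * The six-dimensional metric *)

Section Extension.
Variables (eps : R) (Omega : set 'rV[R]_(3 + 3)).
Hypothesis openOmega : open Omega.
Hypothesis Omega_dom : forall p, Omega p -> domain3 (lsubmx p).

Local Notation Pi := (christoffel (metric3 l)).
Local Notation C := (eps *: delta_mx o1 o1 : 'M[R]_3).
Local Notation g := (deformed_extension Pi C).

Lemma metric6E : metric6 l eps = g.
Proof.
apply/funext => p; rewrite /metric6 /deformed_extension; congr (_ + _).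
apply/matrixP => i j; case: (split_ordP i) => a ->; case: (split_ordP j) => b ->.
- by rewrite block_mxEul !mxE !eq_lshift.
- by rewrite block_mxEur !mxE (eq_sym (rshift _ _)) eq_lrshift andbF mulr0.
- by rewrite block_mxEdl !mxE eq_rlshift mulr0.
- by rewrite block_mxEdr !mxE eq_rlshift mulr0.
Qed.

(** The fibre symbols that enter R_xyxy with a nonzero factor or a derivative, together with one
    that is itself 0. Among them [eps] appears only in the third, with upper index v and lower
    indices x, y. *)
Lemma fibre_explicit (p : 'rV[R]_(3 + 3)) (u := rsubmx p 0 o0)
    (v := rsubmx p 0 o1) (w := rsubmx p 0 o2) (z := (lsubmx p 0 1)^-1)
    (L := jet [::] (lsubmx p)) :
  domain3 (lsubmx p) ->
  [/\ christoffel_fibre Pi C o0 o1 o1 p = (2 * u + v) * z * z,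
      christoffel_fibre Pi C o0 o0 o1 p =
        L * (u + 2 * v) - (2^-1 * u + 4^-1 * v) * z * z - w,
      christoffel_fibre Pi C o1 o0 o1 p =
        (2 * u + v) * z * z - 2^-1 * eps * z,
      christoffel_fibre Pi C o1 o1 o1 p = 0 &
      christoffel_fibre Pi C o2 o1 o1 p = L * (2 * u + v) * z * z].
Proof.
move=> Bp; have [_ y0] := Bp.
have GE k' i' j' := christoffel_metric3 k' i' j' _ Bp.
have AE k m : base_block Pi C k m p =
    - 2 * (christoffel3 o0 k m (lsubmx p) * rsubmx p 0 o0
           + christoffel3 o1 k m (lsubmx p) * rsubmx p 0 o1
           + christoffel3 o2 k m (lsubmx p) * rsubmx p 0 o2) + C k m.
  by rewrite /base_block sum_ord3 !GE.
have CE i j : C i j = eps * ((i == o1) && (j == o1))%:R by rewrite !mxE.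
split.
all: rewrite /christoffel_fibre 2!sum_ord3 3!AE 3!GE.
all: eval_partials Bp.
all: rewrite /jet_partial /christoffel3 3!CE /z /L /=; clear GE AE z L Bp.
all: rewrite /u /v /w {u v w};
  move: (rsubmx p 0 o0) (rsubmx p 0 o1) (rsubmx p 0 o2) => u v w;
  move: y0; move: (lsubmx p) => q y0;
  move: (jet [:: 1; 0] q) (jet [:: 0; 0] q) (jet [:: 1] q) (jet [:: 0] q)
    (jet [::] q) => Lzx Lxx Lz Lx L';
  move: (q 0 1) y0 => y y0.
all: by field.
Qed.

Lemma christoffel_fibreE k i j p : domain3 (lsubmx p) ->
  christoffel g (rshift 3 k) (lshift 3 i) (lshift 3 j) p =
  christoffel_fibre Pi C k i j p.
Proof.
by move=> Bp; apply: christoffel_rll => s a b m; exact: derivable_christoffel.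
Qed.

Lemma partial_fibre d k i j f p c : Omega p ->
  (forall q, domain3 (lsubmx q) -> christoffel_fibre Pi C k i j q = f q) ->
  has_partial d f p c ->
  partial d (christoffel g (rshift 3 k) (lshift 3 i) (lshift 3 j)) p = c.
Proof.
move=> Op fE fd; apply: partialP erefl; apply: has_partial_near fd.
have : \forall q \near p, Omega q.
  exact: (open_nbhs_nbhs (conj openOmega Op)).
by apply: filterS => q /Omega_dom Bq; rewrite christoffel_fibreE // fE.
Qed.

(** The components R^m_yxy with base [m] vanish, so lowering the index leaves R^u_yxy. There [eps]
    enters only through - Gamma^u_yv Gamma^v_xy, whose first symbol is - Pi^y_xy = -1/(2y) and whose
    second contains - eps/(2y); all terms in [l] and the fibre coordinates cancel. *)
Lemma riemann_0101 p : Omega p ->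
  riemann g (lshift 3 o0) (lshift 3 o1) (lshift 3 o0) (lshift 3 o1) p =
  - 4^-1 * eps * (lsubmx p 0 1)^-1 ^+ 2.
Proof.
move=> Op; have Bp := Omega_dom _ Op; have [_ y0] := Bp.
have Pd q : Omega q -> forall s a b m,
    derivable (Pi s a b) (lsubmx q) (delta_mx 0 m).
  by move=> /Omega_dom Bq s a b m; exact: derivable_christoffel.
have GE k' i' j' := christoffel_metric3 k' i' j' _ Bp.
have base m :
    riemann_up g (lshift 3 m) (lshift 3 o1) (lshift 3 o0) (lshift 3 o1) p = 0.
  rewrite /riemann_up !(partial_lll _ _ _ _ _ Pd) // big_split_ord /=.
  rewrite [X in _ + (_ + X)]big1 => [|s _]; last first.
    by rewrite !christoffel_llr !mul0r subrr.
  rewrite sum_ord3 !christoffel_lll !GE.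
  elim/ord3P: m; eval_partials Bp; rewrite /christoffel3 /jet_partial /=;
    clear GE Bp; move: y0; move: (lsubmx p) => q y0;
    move: (jet [:: 1; 0] q) (jet [:: 0; 0] q) (jet [:: 1] q) (jet [:: 0] q)
      (jet [::] q) => Lzx Lxx Lz Lx L;
    move: (q 0 1) y0 => y y0; by field.
rewrite /riemann big_split_ord /=.
rewrite [X in X + _]big1 => [|m _]; last by rewrite base mulr0.
rewrite add0r (bigD1 o0) //= [X in _ + X]big1 => [|m m0]; last first.
  by rewrite ext_lr eq_sym (negPf m0) mul0r.
rewrite ext_lr eqxx mul1r addr0 /riemann_up.
have PiC k i j : Pi k i j = Pi k j i by exact: christoffel_sym metric3_sym _ _ _.
have FE q : domain3 (lsubmx q) -> _ := @fibre_explicit q.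
rewrite (partial_fibre (lshift 3 o0) o0 o1 o1
  (fun q => (2 * rsubmx q 0 o0 + rsubmx q 0 o1) * (lsubmx q 0 1)^-1
            * (lsubmx q 0 1)^-1) p 0 Op); last first.
- apply: has_partial_eq; first by has_partial_base_jets.
  by rewrite /=; field.
- by move=> q /FE[].
(* Only the term in y^-2 depends on y; its derivative is (u + v/2) y^-3. *)
rewrite (partial_fibre (lshift 3 o1) o0 o0 o1
  (fun q => jet [::] (lsubmx q) * (rsubmx q 0 o0 + 2 * rsubmx q 0 o1)
     - (2^-1 * rsubmx q 0 o0 + 4^-1 * rsubmx q 0 o1) * (lsubmx q 0 1)^-1
       * (lsubmx q 0 1)^-1 - rsubmx q 0 o2) p
  ((rsubmx p 0 o0 + 2^-1 * rsubmx p 0 o1) * (lsubmx p 0 1)^-1 ^+ 3) Op); last first.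
- apply: has_partial_eq; first by has_partial_base_jets.
  by rewrite /jet_partial /=; field.
- by move=> q /FE[].
rewrite big_split_ord /= !sum_ord3.
rewrite !christoffel_lll !christoffel_rlr !christoffel_fibreE //.
rewrite (christoffel_fibreC _ _ _ _ PiC o0 o1 o0).
have [-> -> -> -> ->] := FE p Bp.
rewrite !GE /christoffel3 /=; move: y0 (jet _ _) => /=.
move: (lsubmx p 0 1) (rsubmx p 0 o0) (rsubmx p 0 o1) (rsubmx p 0 o2) => y u v w y0 L.
by field.
Qed.
End Extension.
End KdVMetric.

(** * Ricci-flatness and nonzero curvature *)

Theorem theorem4 (R : realType) (D : set 'rV[R]_2) (l : 'rV[R]_2 -> R)
    (openD : open D) (smooth_l : smooth_on D l)
    (kdv : forall q : 'rV[R]_2, D q -> kdv_equation l q)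
    (Omega : set 'rV[R]_(3 + 3)) (openOmega : open Omega)
    (Omega_neq0 : Omega !=set0)
    (Omega_dom : forall p : 'rV[R]_(3 + 3), Omega p ->
      D (proj_xz (lsubmx p)) /\ lsubmx p 0 1 != 0)
    (eps : R) (eps_neq0 : eps != 0) :
  (forall (i k : 'I_(3 + 3)) (p : 'rV[R]_(3 + 3)), Omega p ->
     ricci (metric6 l eps) i k p = 0) /\
  ~ (forall (i j k m : 'I_(3 + 3)) (p : 'rV[R]_(3 + 3)), Omega p ->
       riemann (metric6 l eps) i j k m p = 0).
Proof.
rewrite metric6E; split=> [i k p Op|flat].
  case: (split_ordP i) => a ->; case: (split_ordP k) => b ->.
  - rewrite (ricci_ll _ _ _ _ _ _ openOmega) //; last 2 first.
    + by move=> *; exact: christoffel_sym (metric3_sym _ _) _ _ _.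
    + move=> q /Omega_dom Bq s c d m.
      exact: (derivable_christoffel _ _ _ openD smooth_l).
    have Bp := Omega_dom _ Op; have kdvp := kdv _ Bp.1.
    by rewrite !(connection_ricci_metric3 _ _ _ openD smooth_l) // addr0.
  - exact: ricci_lr.
  - exact: ricci_rl.
  - exact: ricci_rr.
(* R_xyxy = - eps / (4 y^2) is nonzero at every point of [Omega], so any one point refutes
   flatness. *)
have [p Op] := Omega_neq0; have [_ y0] := Omega_dom _ Op.
have /eqP := flat (lshift 3 o0) (lshift 3 o1) (lshift 3 o0) (lshift 3 o1) p Op.
rewrite (riemann_0101 _ _ _ openD smooth_l _ _ openOmega Omega_dom _ Op).
by apply/negP; rewrite !mulf_neq0 // ?oppr_eq0 ?invr_eq0 ?pnatr_eq0.
Qed.
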